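(* Fix a time $k$ and let $Y(k)=\{y_1(k),\dots,y_n(k)\}$ be the measurements of the $n\ge 2$ sensors of a cluster, $y_i(k)=C(k)x(k)+\upsilon_i(k)\in\mathbb{R}^q$, where the noises $\upsilon_1(k),\dots,\upsilon_n(k)$ are zero-mean, mutually uncorrelated, with positive definite covariance matrices $R_i(k)=\mathrm{Cov}\{\upsilon_i(k)\}$. Let $y_{(0)}(k)=y_1(k)$ and, for $j=1,\dots,n-1$, let $y_{(j)}(k)=f_m\{y_{(j-1)}(k),y_{j+1}(k)\}$ be the $j$th sequentially fused measurement, where $f_m$ is the weighted-least-squares fusion operator defined in the context. Write $\upsilon_{(j)}(k)=y_{(j)}(k)-C(k)x(k)$ and $R_{(j)}(k)=\mathrm{Cov}\{\upsilon_{(j)}(k)\}$, so that $R_{(0)}(k)=R_1(k)$. Then, for $j=1,\dots,n-1$, $$R_{(j)}(k)=\left[R_{(j-1)}^{-1}(k)+R_{j+1}^{-1}(k)\right]^{-1},$$ $$y_{(j)}(k)=R_{(j)}(k)\left[R_{(j-1)}^{-1}(k)\,y_{(j-1)}(k)+R_{j+1}^{-1}(k)\,y_{j+1}(k)\right].$$ The final fused measurement $y_f^s(k)$ and its noise covariance $R_f^s(k)$ are $y_f^s(k)=y_{(n-1)}(k)$ and $R_f^s(k)=R_{(n-1)}(k)$. Moreover, $R_{(j)}(k)\le R_{(j-1)}(k)$ for $j=1,\dots,n-1$, and $R_f^s(k)\le R_i(k)$ for every $i\in\{1,\dots,n\}$.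
   Context: $x(k)\in\mathbb{R}^{n_x}$ is the state of a discrete-time linear stochastic system and $C(k)\in\mathbb{R}^{q\times n_x}$ is the measurement matrix, common to all sensors of the cluster. $\mathrm{Cov}$ denotes the covariance matrix. For symmetric matrices, $X\le Y$ means that $Y-X$ is positive semidefinite. Sequential measurement fusion (SMF): the measurements are fused one at a time in the order $y_1,\dots,y_n$. The fusion operator $f_m$ is the weighted least squares (WLS) estimate of $C(k)x(k)$ from two measurements: stacking $$z_{(j)}=\begin{bmatrix}y_{(j-1)}\\ y_{j+1}\end{bmatrix}=e\,Cx+\bar\upsilon_{(j)},\qquad e=\begin{bmatrix}I\\ I\end{bmatrix},\qquad \bar\upsilon_{(j)}=\begin{bmatrix}\upsilon_{(j-1)}\\ \upsilon_{j+1}\end{bmatrix},\qquad \bar R_{(j)}=\mathrm{Cov}\{\bar\upsilon_{(j)}\},$$ (with $I$ the $q\times q$ identity), one sets $$y_{(j)}=f_m\{y_{(j-1)},y_{j+1}\}=[e^{\mathrm T}\bar R_{(j)}^{-1}e]^{-1}e^{\mathrm T}\bar R_{(j)}^{-1}z_{(j)},$$ i.e. the minimizer over $u\in\mathbb{R}^q$ of $(z_{(j)}-eu)^{\mathrm T}\bar R_{(j)}^{-1}(z_{(j)}-eu)$. *)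

(* Defs.v *)
From HB Require Import structures.
From mathcomp Require Import all_boot all_order all_algebra.
From mathcomp Require Import all_classical all_reals all_analysis.
Set Implicit Arguments.
Unset Strict Implicit.
Unset Printing Implicit Defensive.
Import Order.TTheory GRing.Theory Num.Theory.
Local Open Scope ring_scope.

Definition psdmx (R : realType) (q : nat) (A : 'M[R]_q) : Prop :=
  A^T = A /\ forall u : 'cV[R]_q, 0 <= (u^T *m A *m u) 0 0.

Definition pdmx (R : realType) (q : nat) (A : 'M[R]_q) : Prop :=
  A^T = A /\ forall u : 'cV[R]_q, u != 0 -> 0 < (u^T *m A *m u) 0 0.

Definition loewner_le (R : realType) (q : nat) (A B : 'M[R]_q) : Prop :=
  psdmx (B - A).

Section RandomVectors.
Context (d : measure_display) (T : measurableType d) (R : realType).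
Variable P : probability T R.

(* The library has no sigma-algebra on matrices; measurability of a vector-valued
   map is that of its coordinates. *)
Definition random_vector (m : nat) (X : T -> 'cV[R]_m) : Prop :=
  forall a : 'I_m, measurable_fun [set: T] (fun w => X w a 0).

(* [Lfun P 2] includes measurability. *)
Definition square_integrable (m : nat) (X : T -> 'cV[R]_m) : Prop :=
  forall a : 'I_m, (fun w => X w a 0) \in Lfun P 2%:E.

Definition zero_mean (m : nat) (X : T -> 'cV[R]_m) : Prop :=
  forall a : 'I_m, ('E_P[fun w => X w a 0%R] = 0)%E.

(* [covariance] is extended-real valued; it is finite, so that [fine] loses
   nothing, as soon as [X] and [Y] are square integrable. *)
Definition cross_covmx (m p : nat) (X : T -> 'cV[R]_m) (Y : T -> 'cV[R]_p)
    : 'M[R]_(m, p) :=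
  \matrix_(a < m, b < p)
    fine (covariance P (fun w => X w a 0) (fun w => Y w b 0)).

Definition covmx (m : nat) (X : T -> 'cV[R]_m) : 'M[R]_m := cross_covmx X X.

Definition uncorrelated (m p : nat) (X : T -> 'cV[R]_m) (Y : T -> 'cV[R]_p)
    : Prop :=
  cross_covmx X Y = 0.

End RandomVectors.

(* The weighted least squares estimate of [u] from [z = e u + noise], where
   [e = [I; I]] and the noise has covariance [Rbar]. *)
Definition wls (R : realType) (q : nat) (Rbar : 'M[R]_(q + q))
    (z : 'cV[R]_(q + q)) : 'cV[R]_q :=
  let e : 'M[R]_(q + q, q) := col_mx 1%:M 1%:M in
  invmx (e^T *m invmx Rbar *m e) *m e^T *m invmx Rbar *m z.

Section SequentialFusion.
Context (d : measure_display) (T : measurableType d) (R : realType).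
Variables (P : probability T R) (nx q : nat).
Variables (C : 'M[R]_(q, nx)) (x : T -> 'cV[R]_nx).

Definition meas_noise (Y : T -> 'cV[R]_q) : T -> 'cV[R]_q :=
  fun w => Y w - C *m x w.

(* The weight is the joint covariance of the two noises, including their
   cross-covariance blocks. *)
Definition fuse (Y1 Y2 : T -> 'cV[R]_q) : T -> 'cV[R]_q :=
  let Rbar := covmx P (fun w => col_mx (meas_noise Y1 w) (meas_noise Y2 w)) in
  fun w => wls Rbar (col_mx (Y1 w) (Y2 w)).

(* Sensors are numbered from 1; [y 0] is never used. *)
Variable y : nat -> T -> 'cV[R]_q.

Fixpoint seq_fused (j : nat) : T -> 'cV[R]_q :=
  if j is j'.+1 then fuse (seq_fused j') (y j'.+2) else y 1%N.

Definition seq_fused_cov (j : nat) : 'M[R]_q :=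
  covmx P (meas_noise (seq_fused j)).

(* The result of fusing the whole list [y 1, ..., y n] from left to right. *)
Definition final_fused (n : nat) : T -> 'cV[R]_q :=
  foldl fuse (y 1%N) [seq y i | i <- iota 2 n.-1].

Definition final_fused_cov (n : nat) : 'M[R]_q :=
  covmx P (meas_noise (final_fused n)).

End SequentialFusion.

(* Main.v *)
(* Since y_(j-1) only involves sensors 1..j, its noise is uncorrelated with that
   of sensor j+1; the joint covariance is then block diagonal and the WLS weight
   is the parallel sum S = (A^-1 + B^-1)^-1 of the two covariances A and B. The
   gains S A^-1 and S B^-1 add up to I, so C x cancels and the fused noise is a
   combination of the two noises, with covariance S. *)
Require Import Defs.
From mathcomp Require Import all_boot all_order all_algebra.
From mathcomp Require Import all_classical all_reals all_analysis.
Import Order.TTheory GRing.Theory Num.Theory.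
Set Implicit Arguments.
Unset Strict Implicit.
Unset Printing Implicit Defensive.
Local Open Scope ring_scope.

(** * Positive definite matrices, the Loewner order and the parallel sum *)

Section PositiveDefinite.
Context {R : realType} {q : nat}.
Implicit Types A B S : 'M[R]_q.

Lemma pdmx_psd A : pdmx A -> psdmx A.
Proof.
case=> At Ap; split=> // u; have [->|/Ap/ltW//] := eqVneq u 0.
by rewrite mulmx0 mxE.
Qed.

(** A nonzero row [v] with [v *m A = 0] would make the quadratic form vanish at [v^T]. *)
Lemma pdmx_unit A : pdmx A -> A \in unitmx.
Proof.
case=> At Ap; rewrite -row_free_unit -kermx_eq0.
apply/negPn/negP => /rowV0Pn[v /sub_kermxP vA0 v0].
have := Ap v^T; rewrite trmx_eq0 trmxK vA0 mul0mx mxE ltxx => /(_ v0).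
by [].
Qed.

Lemma pdmx_inv A : pdmx A -> pdmx (invmx A).
Proof.
move=> Apd; have Au := pdmx_unit Apd; have [At Ap] := Apd.
split=> [|u u0]; first by rewrite trmx_inv At.
(* The form of [invmx A] at [u] is the form of [A] at [invmx A *m u]. *)
have /Ap : invmx A *m u != 0.
  by apply: contra_neq u0 => Au0; rewrite -(mulKVmx Au u) Au0 mulmx0.
by rewrite trmx_mul trmx_inv At -!mulmxA (mulmxA A) mulmxV // mul1mx !mulmxA.
Qed.

Lemma pdmxD A B : pdmx A -> pdmx B -> pdmx (A + B).
Proof.
move=> [At Ap] [Bt Bp]; split=> [|u u0]; first by rewrite raddfD /= At Bt.
by rewrite mulmxDr mulmxDl mxE addr_gt0 ?Ap ?Bp.
Qed.

Lemma psdmxD A B : psdmx A -> psdmx B -> psdmx (A + B).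
Proof.
move=> [At Ap] [Bt Bp]; split=> [|u]; first by rewrite raddfD /= At Bt.
by rewrite mulmxDr mulmxDl mxE addr_ge0 ?Ap ?Bp.
Qed.

Lemma psdmx_congr A S : psdmx A -> psdmx (S *m A *m S^T).
Proof.
move=> [At Ap]; split=> [|u]; first by rewrite !trmx_mul trmxK At mulmxA.
by have := Ap (S^T *m u); rewrite trmx_mul trmxK !mulmxA.
Qed.

Lemma loewner_le_refl A : loewner_le A A.
Proof.
by rewrite /loewner_le subrr; split=> [|u]; rewrite ?trmx0 // mulmx0 mul0mx mxE.
Qed.

Lemma loewner_le_trans B A S : loewner_le A B -> loewner_le B S ->
  loewner_le A S.
Proof.
by move=> AB BS; have := psdmxD BS AB; rewrite /loewner_le addrA subrK.
Qed.

Definition par_sum A B : 'M[R]_q := invmx (invmx A + invmx B).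

Lemma par_sumC A B : par_sum A B = par_sum B A.
Proof. by rewrite /par_sum addrC. Qed.

Lemma par_sum_pd A B : pdmx A -> pdmx B -> pdmx (par_sum A B).
Proof. by move=> Ap Bp; apply/pdmx_inv/pdmxD; apply: pdmx_inv. Qed.

Lemma par_sumK A B : pdmx A -> pdmx B ->
  par_sum A B *m (invmx A + invmx B) = 1%:M.
Proof.
by move=> Ap Bp; rewrite mulVmx // pdmx_unit //; apply/pdmxD; apply: pdmx_inv.
Qed.

(* With [S = (A^-1 + B^-1)^-1], [A - S = S (B^-1 + B^-1 A B^-1) S]. *)
Lemma par_sum_le A B : pdmx A -> pdmx B -> loewner_le (par_sum A B) A.
Proof.
move=> Ap Bp; have Sp := par_sum_pd Ap Bp; have Au := pdmx_unit Ap.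
have Du : invmx A + invmx B \in unitmx.
  by apply/pdmx_unit/pdmxD; apply: pdmx_inv.
set S := par_sum A B in Sp *.
(* Multiplying by [D = invmx A + invmx B], the inverse of [S], on both sides removes [S]:
   [D S D = D], while [D A D] is [D] plus the right-hand side. The transpose, harmless as [B] is
   symmetric, gives the shape required by [psdmx_congr]. *)
have DE : (invmx A + invmx B) *m (A - S) *m (invmx A + invmx B)
          = invmx B + invmx B *m A *m (invmx B)^T.
  have DA : (invmx A + invmx B) *m A = 1%:M + invmx B *m A.
    by rewrite mulmxDl mulVmx.
  rewrite trmx_inv (proj1 Bp) mulmxBr [_ *m S]mulmxV // mulmxBl mul1mx DA.
  by rewrite mulmxDl mul1mx mulmxDr (mulmxK Au) addrC addKr.
rewrite /loewner_le.
have -> : A - S = S *m (invmx B + invmx B *m A *m (invmx B)^T) *m S^T.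
  rewrite -DE (proj1 Sp) /S /par_sum -!mulmxA mulmxV // mulmx1.
  by rewrite mulKmx.
apply: psdmx_congr; apply: psdmxD; first exact/pdmx_psd/pdmx_inv.
exact/psdmx_congr/pdmx_psd.
Qed.

End PositiveDefinite.

(** * Weighted least squares with a block diagonal weight *)

Section Wls.
Context {R : realType} {q : nat}.

(** The weight inverts blockwise, so [e^T] times its inverse is the row of [invmx R1] and
    [invmx R2]; multiplying by [e] adds the two blocks. *)
Lemma wls_block_diag (R1 R2 : 'M[R]_q) (z1 z2 : 'cV[R]_q) :
    R1 \in unitmx -> R2 \in unitmx ->
  wls (block_mx R1 0 0 R2) (col_mx z1 z2) =
  par_sum R1 R2 *m (invmx R1 *m z1 + invmx R2 *m z2).
Proof.
move=> R1u R2u; rewrite /wls invmx_block_diag; last first.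
  by rewrite block_diag_mx_unit R1u.
rewrite tr_col_mx !trmx1 -!mulmxA mul_block_col !mul0mx addr0 add0r !mulmx1.
rewrite mul_row_col !mul1mx mul_block_col mul_row_col !mul0mx !mul1mx.
by rewrite addr0 add0r.
Qed.

End Wls.

(** * Bilinearity of cross-covariance matrices on square integrable vectors *)

Section Covariance.
Context {d : measure_display} {T : measurableType d} {R : realType}.
Variable P : probability T R.

Lemma Lfun2D (f g : T -> R) : f \in Lfun P 2%:E -> g \in Lfun P 2%:E ->
  (fun w => f w + g w) \in Lfun P 2%:E.
Proof.
have p1 : (1 <= 2%:E :> \bar R)%E by rewrite lee_fin ler1n.
by move=> f2 g2; have [_ D] := Lfun_addr_closed P p1; exact: (D f g).
Qed.

Lemma Lfun2Z a (f : T -> R) : f \in Lfun P 2%:E ->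
  (fun w => a * f w) \in Lfun P 2%:E.
Proof.
(* [a \o* f] multiplies by [a] on the right, hence the appeal to commutativity. *)
move=> f2; have -> : (fun w => a * f w) = (a \o* f)%R.
  by apply/funext => w; rewrite /= mulrC.
by rewrite Lfun_scale ?ler1n.
Qed.

Lemma Lfun2_sum (I : Type) (r : seq I) (f : I -> T -> R) :
    (forall i, f i \in Lfun P 2%:E) ->
  (fun w => \sum_(i <- r) f i w) \in Lfun P 2%:E.
Proof.
move=> f2; elim: r => [|i r IH].
  under eq_fun do rewrite big_nil.
  exact: Lfun_cst.
under eq_fun do rewrite big_cons.
exact: Lfun2D.
Qed.

Lemma Lfun2_Lfun1 (f : T -> R) : f \in Lfun P 2%:E -> f \in Lfun P 1.
Proof. by apply: Lfun_subset12; exact: fin_num_measure. Qed.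

Lemma covariance2_fin_num (f g : T -> R) : f \in Lfun P 2%:E ->
  g \in Lfun P 2%:E -> covariance P f g \is a fin_num.
Proof.
move=> f2 g2.
exact: covariance_fin_num (Lfun2_Lfun1 f2) (Lfun2_Lfun1 g2)
  (Lfun2_mul_Lfun1 f2 g2).
Qed.

(** Square integrability keeps every partial covariance finite, which is what lets [fine] commute
    with the extended-real sums and products. *)
Lemma fine_covariance_sum (I : Type) (r : seq I) (a : I -> R) (f : I -> T -> R)
    (g : T -> R) : (forall i, f i \in Lfun P 2%:E) -> g \in Lfun P 2%:E ->
  fine (covariance P (fun w => \sum_(i <- r) a i * f i w) g) =
  \sum_(i <- r) a i * fine (covariance P (f i) g).
Proof.
move=> f2 g2; elim: r => [|i r IH].
  under eq_fun do rewrite big_nil.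
  by rewrite covariance_cst_l big_nil.
under eq_fun do rewrite big_cons.
have af2 : forall i, (fun w => a i * f i w) \in Lfun P 2%:E.
  by move=> k; exact: Lfun2Z.
rewrite covarianceDl ?Lfun2_sum // fineD ?covariance2_fin_num ?Lfun2_sum //.
rewrite IH big_cons; congr (_ + _).
have -> : (fun w => a i * f i w) = (a i \o* f i)%R.
  by apply/funext => w; rewrite /= mulrC.
rewrite (covarianceZl _ _ _ (Lfun2_mul_Lfun1 (f2 i) g2)) ?Lfun2_Lfun1 //.
by rewrite fineM // covariance2_fin_num.
Qed.

Lemma fine_covarianceD (f1 f2 g : T -> R) : f1 \in Lfun P 2%:E ->
    f2 \in Lfun P 2%:E -> g \in Lfun P 2%:E ->
  fine (covariance P (fun w => f1 w + f2 w) g) =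
  fine (covariance P f1 g) + fine (covariance P f2 g).
Proof.
by move=> *; rewrite covarianceDl // fineD ?covariance2_fin_num.
Qed.

Lemma square_integrableD m (X Y : T -> 'cV[R]_m) : square_integrable P X ->
  square_integrable P Y -> square_integrable P (fun w => X w + Y w).
Proof. by move=> X2 Y2 a; under eq_fun do rewrite mxE; exact: Lfun2D. Qed.

Lemma square_integrable_mulmx m p (A : 'M[R]_(p, m)) (X : T -> 'cV[R]_m) :
  square_integrable P X -> square_integrable P (fun w => A *m X w).
Proof.
move=> X2 a; under eq_fun do rewrite mxE.
by apply: Lfun2_sum => k; exact: Lfun2Z.
Qed.

Lemma cross_covmxDl m p (X Y : T -> 'cV[R]_m) (Z : T -> 'cV[R]_p) :
    square_integrable P X -> square_integrable P Y -> square_integrable P Z ->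
  cross_covmx P (fun w => X w + Y w) Z = cross_covmx P X Z + cross_covmx P Y Z.
Proof.
move=> X2 Y2 Z2; apply/matrixP => a b; rewrite !mxE.
by under eq_fun do rewrite mxE; rewrite fine_covarianceD.
Qed.

Lemma cross_covmx_mull m p l (A : 'M[R]_(l, m)) (X : T -> 'cV[R]_m)
    (Z : T -> 'cV[R]_p) : square_integrable P X -> square_integrable P Z ->
  cross_covmx P (fun w => A *m X w) Z = A *m cross_covmx P X Z.
Proof.
move=> X2 Z2; apply/matrixP => a b; rewrite !mxE.
under eq_fun do rewrite mxE.
rewrite fine_covariance_sum //.
by apply: eq_bigr => k _; rewrite mxE.
Qed.

(** Carries linearity in the first argument over to the second. *)
Lemma trmx_cross_covmx m p (X : T -> 'cV[R]_m) (Z : T -> 'cV[R]_p) :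
  (cross_covmx P X Z)^T = cross_covmx P Z X.
Proof. by apply/matrixP => a b; rewrite !mxE covarianceC. Qed.

Lemma uncorrelatedC m p (X : T -> 'cV[R]_m) (Z : T -> 'cV[R]_p) :
  uncorrelated P X Z -> uncorrelated P Z X.
Proof. by move=> XZ; rewrite /uncorrelated -trmx_cross_covmx XZ trmx0. Qed.

Lemma uncorrelated_comb m p l (A B : 'M[R]_(l, m)) (X Y : T -> 'cV[R]_m)
    (Z : T -> 'cV[R]_p) :
    square_integrable P X -> square_integrable P Y -> square_integrable P Z ->
    uncorrelated P X Z -> uncorrelated P Y Z ->
  uncorrelated P (fun w => A *m X w + B *m Y w) Z.
Proof.
move=> X2 Y2 Z2 XZ YZ; rewrite /uncorrelated.
have A2 := square_integrable_mulmx A X2.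
have B2 := square_integrable_mulmx B Y2.
by rewrite cross_covmxDl // !cross_covmx_mull // XZ YZ !mulmx0 addr0.
Qed.

Lemma covmx_comb m l (A B : 'M[R]_(l, m)) (X Y : T -> 'cV[R]_m) :
    square_integrable P X -> square_integrable P Y -> uncorrelated P X Y ->
  covmx P (fun w => A *m X w + B *m Y w) =
  A *m covmx P X *m A^T + B *m covmx P Y *m B^T.
Proof.
move=> X2 Y2 XY; have YX := uncorrelatedC XY.
have A2 := square_integrable_mulmx A X2.
have B2 := square_integrable_mulmx B Y2.
have S2 := square_integrableD A2 B2.
rewrite /covmx cross_covmxDl // !cross_covmx_mull //.
(* The sum now sits in the second argument; transposing brings it to the first, where it expands,
   and the mixed terms vanish. *)
rewrite -(trmx_cross_covmx _ X) -(trmx_cross_covmx _ Y) !cross_covmxDl //.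
rewrite !cross_covmx_mull // XY YX !mulmx0 addr0 add0r.
by rewrite !trmx_mul !trmx_cross_covmx !mulmxA.
Qed.

Lemma covmx_col m1 m2 (X : T -> 'cV[R]_m1) (Y : T -> 'cV[R]_m2) :
  covmx P (fun w => col_mx (X w) (Y w)) =
  block_mx (covmx P X) (cross_covmx P X Y) (cross_covmx P Y X) (covmx P Y).
Proof.
apply/matrixP => a b; rewrite mxE.
case: (split_ordP a) => a' ->; case: (split_ordP b) => b' ->;
  rewrite ?(block_mxEul, block_mxEur, block_mxEdl, block_mxEdr) mxE;
  by under eq_fun do rewrite ?(col_mxEu, col_mxEd);
     under [X in covariance _ _ X]eq_fun do rewrite ?(col_mxEu, col_mxEd).
Qed.

End Covariance.

(** * Fusion of two measurements, then induction along the sensors *)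

Section Fusion.
Context {d : measure_display} {T : measurableType d} {R : realType}.
Variables (P : probability T R) (nx q : nat).
Variables (C : 'M[R]_(q, nx)) (x : T -> 'cV[R]_nx).

Section TwoMeasurements.
Variables Y1 Y2 : T -> 'cV[R]_q.
Let N1 := meas_noise C x Y1.
Let N2 := meas_noise C x Y2.
Let R1 := covmx P N1.
Let R2 := covmx P N2.
Hypotheses (N1L2 : square_integrable P N1) (N2L2 : square_integrable P N2).
Hypotheses (N12 : uncorrelated P N1 N2) (R1pd : pdmx R1) (R2pd : pdmx R2).

Lemma fuseE w : fuse P C x Y1 Y2 w =
  par_sum R1 R2 *m (invmx R1 *m Y1 w + invmx R2 *m Y2 w).
Proof.
rewrite /fuse covmx_col -/N1 -/N2 N12 (uncorrelatedC N12).
by rewrite wls_block_diag ?pdmx_unit.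
Qed.

(* The two gains add up to the identity, so [C x] cancels. *)
Lemma meas_noise_fuse : meas_noise C x (fuse P C x Y1 Y2) =
  fun w => par_sum R1 R2 *m invmx R1 *m N1 w
           + par_sum R1 R2 *m invmx R2 *m N2 w.
Proof.
apply/funext => w; rewrite /meas_noise fuseE /N1 /N2 /meas_noise.
rewrite -[in LHS](mul1mx (C *m x w)) -(par_sumK R1pd R2pd).
by rewrite -mulmxA -mulmxBr mulmxDl opprD addrACA -!mulmxBr mulmxDr !mulmxA.
Qed.

Lemma fuse_square_integrable :
  square_integrable P (meas_noise C x (fuse P C x Y1 Y2)).
Proof.
by rewrite meas_noise_fuse; apply: square_integrableD;
  apply: square_integrable_mulmx.
Qed.

Lemma fuse_uncorrelated (Z : T -> 'cV[R]_q) : square_integrable P Z ->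
    uncorrelated P N1 Z -> uncorrelated P N2 Z ->
  uncorrelated P (meas_noise C x (fuse P C x Y1 Y2)) Z.
Proof. by move=> *; rewrite meas_noise_fuse; apply: uncorrelated_comb. Qed.

(** With [S] the parallel sum, the gain [S R1^-1] contributes [S R1^-1 R1 R1^-1 S = S R1^-1 S], and
    likewise for [R2]; the total [S (R1^-1 + R2^-1) S] collapses to [S]. *)
Lemma fuse_cov : covmx P (meas_noise C x (fuse P C x Y1 Y2)) = par_sum R1 R2.
Proof.
rewrite meas_noise_fuse covmx_comb // -/R1 -/R2.
have [St _] := par_sum_pd R1pd R2pd.
rewrite !trmx_mul St !trmx_inv (proj1 R1pd) (proj1 R2pd) -!mulmxA.
rewrite !mulKVmx ?pdmx_unit //.
by rewrite -mulmxDr -mulmxDl mulmxA par_sumK // mul1mx.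
Qed.

End TwoMeasurements.

Lemma final_fusedE (y : nat -> T -> 'cV[R]_q) n :
  final_fused P C x y n = seq_fused P C x y n.-1.
Proof.
rewrite /final_fused; elim: n.-1 => // k IH.
(* Splitting off the last index [k.+2] makes the final [foldl] step the recursive step of
   [seq_fused]. *)
by rewrite -[X in iota _ X]addn1 iotaD map_cat foldl_cat IH.
Qed.

(** The induction invariant. Stage [j] has absorbed sensors 1 to [j.+1], so the remaining ones start
    at [j.+2]. Uncorrelatedness is claimed for all of them, since the next sensor alone would not
    propagate to the following stage. *)
Lemma seq_fused_noise (n : nat) (v y : nat -> T -> 'cV[R]_q)
    (hv : forall i, (1 <= i <= n)%N -> meas_noise C x (y i) = v i)
    (hv2 : forall i, (1 <= i <= n)%N -> square_integrable P (v i))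
    (hvu : forall i l : nat, (1 <= i <= n)%N -> (1 <= l <= n)%N -> i <> l ->
      uncorrelated P (v i) (v l))
    (hvR : forall i, (1 <= i <= n)%N -> pdmx (covmx P (v i))) j :
    (j < n)%N ->
  let N := meas_noise C x (seq_fused P C x y j) in
  [/\ square_integrable P N, pdmx (covmx P N) &
      forall l, (j.+2 <= l <= n)%N -> uncorrelated P N (v l)].
Proof.
elim: j => [|j IH] jn /=.
  rewrite hv //; split; [exact: hv2|exact: hvR|move=> l /andP[l2 ln]].
  by apply: hvu; rewrite ?(ltnW l2) //; case: l l2 {ln} => [|[]].
have [N2 Npd Nu] := IH (ltnW jn).
have vj := hv j.+2 jn.
have jj : uncorrelated P (meas_noise C x (seq_fused P C x y j))
                         (meas_noise C x (y j.+2)).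
  by rewrite vj; apply: Nu; rewrite leqnn.
have L2 : square_integrable P (meas_noise C x (y j.+2)).
  by rewrite vj; exact: hv2.
have pd2 : pdmx (covmx P (meas_noise C x (y j.+2))) by rewrite vj; exact: hvR.
split; first exact: fuse_square_integrable.
- by rewrite fuse_cov //; exact: par_sum_pd.
- move=> l /andP[jl ln].
  have l1n : (1 <= l <= n)%N by rewrite ln (leq_trans _ jl).
  apply: fuse_uncorrelated => //; first exact: hv2.
  + by apply: Nu; rewrite ln (ltnW jl).
  + by rewrite vj; apply: hvu => // jl'; rewrite -jl' ltnn in jl.
Qed.

End Fusion.

Theorem theorem1 (d : measure_display) (T : measurableType d) (R : realType)
  (P : probability T R) (nx q n : nat) (hn : (2 <= n)%N)
  (C : 'M[R]_(q, nx)) (x : T -> 'cV[R]_nx) (hx : random_vector x)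
  (v y : nat -> T -> 'cV[R]_q)
  (hy : forall (i : nat) (w : T), (1 <= i <= n)%N -> y i w = C *m x w + v i w)
  (hv2 : forall i : nat, (1 <= i <= n)%N -> square_integrable P (v i))
  (hv0 : forall i : nat, (1 <= i <= n)%N -> zero_mean P (v i))
  (hvu : forall i l : nat, (1 <= i <= n)%N -> (1 <= l <= n)%N -> i <> l ->
     uncorrelated P (v i) (v l))
  (hvR : forall i : nat, (1 <= i <= n)%N -> pdmx (covmx P (v i))) :
  let Ri := fun i : nat => covmx P (v i) in
  let ys := seq_fused P C x y in
  let Rs := seq_fused_cov P C x y in
  let yf := final_fused P C x y n in
  let Rf := final_fused_cov P C x y n in
  [/\ Rs 0%N = Ri 1%N,
      forall j : nat, (1 <= j <= n.-1)%N ->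
        Rs j = invmx (invmx (Rs j.-1) + invmx (Ri j.+1)) /\
        (forall w : T, ys j w =
           Rs j *m (invmx (Rs j.-1) *m ys j.-1 w + invmx (Ri j.+1) *m y j.+1 w)),
      yf = ys n.-1 /\ Rf = Rs n.-1,
      forall j : nat, (1 <= j <= n.-1)%N -> loewner_le (Rs j) (Rs j.-1) &
      forall i : nat, (1 <= i <= n)%N -> loewner_le Rf (Ri i)].
Proof.
have hv i : (1 <= i <= n)%N -> meas_noise C x (y i) = v i.
  by move=> hi; apply/funext => w; rewrite /meas_noise hy // addrC addKr.
move=> Ri ys Rs yf Rf.
have noise := seq_fused_noise hv hv2 hvu hvR.
have Rs0 : Rs 0%N = Ri 1%N by rewrite /Rs /seq_fused_cov /= hv // (ltnW hn).
(* The two recursions are indexed by the successor, which removes the predecessors of the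
   statement. *)
have step j : (j.+1 < n)%N -> Rs j.+1 = par_sum (Rs j) (Ri j.+2) /\
    forall w, ys j.+1 w =
      Rs j.+1 *m (invmx (Rs j) *m ys j w + invmx (Ri j.+2) *m y j.+2 w).
  move=> jn; have [N2 Npd Nu] := noise j (ltnW jn).
  have vj : meas_noise C x (y j.+2) = v j.+2 by exact: hv.
  have jj : uncorrelated P (meas_noise C x (ys j)) (meas_noise C x (y j.+2)).
    by rewrite vj; apply: Nu; rewrite leqnn.
  have L2 : square_integrable P (meas_noise C x (y j.+2)).
    by rewrite vj; exact: hv2.
  have pd2 : pdmx (covmx P (meas_noise C x (y j.+2))) by rewrite vj; exact: hvR.
  have RsE : Rs j.+1 = par_sum (Rs j) (Ri j.+2).
    by rewrite /Rs /seq_fused_cov /= fuse_cov // vj.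
  by split=> // w; rewrite RsE /ys /= fuseE // vj.
have Rspd j : (j < n)%N -> pdmx (Rs j) by case/noise.
have Rs_le j : (j.+1 < n)%N -> loewner_le (Rs j.+1) (Rs j).
  move=> jn; rewrite (proj1 (step j jn)); apply: par_sum_le; last exact: hvR.
  exact: Rspd (ltnW jn).
(* Sensor [j.+1] is the one absorbed at stage [j]; as the parallel sum is symmetric, it is bounded
   by this argument too. *)
have Rs_leR j : (j < n)%N -> loewner_le (Rs j) (Ri j.+1).
  case: j => [_|j jn]; first by rewrite Rs0; exact: loewner_le_refl.
  rewrite (proj1 (step j jn)) par_sumC; apply: par_sum_le; first exact: hvR.
  exact: Rspd (ltnW jn).
have Rs_mono i k : (i + k < n)%N -> loewner_le (Rs (i + k)%N) (Rs i).
  elim: k => [|k IH]; first by rewrite addn0 => _; exact: loewner_le_refl.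
  rewrite addnS => ikn; apply: loewner_le_trans (Rs_le _ ikn) _.
  exact: IH (ltnW ikn).
have n0 : (0 < n)%N := ltnW hn.
have yfE : yf = ys n.-1 by exact: final_fusedE.
have RfE : Rf = Rs n.-1 by rewrite /Rf /final_fused_cov final_fusedE.
split=> //.
- by case=> // j /andP[_ jn]; apply: step; rewrite -(prednK n0) ltnS.
- by case=> // j /andP[_ jn]; apply: Rs_le; rewrite -(prednK n0) ltnS.
(* The sensor is now [i.+1], which enters at stage [i]: the chain is
   [Rs n.-1 <= Rs i <= Ri i.+1]. *)
- case=> // i /andP[_ iln]; rewrite RfE.
  apply: loewner_le_trans (Rs_leR i iln).
  have i_le : (i <= n.-1)%N by rewrite -ltnS prednK.
  by rewrite -(subnKC i_le); apply: Rs_mono; rewrite subnKC // prednK.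
Qed.
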